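(* Let $G$ be an abelian group. Then $\operatorname{asdim}\ell\text{-}\mathcal L(G)=0$ if and only if $G$ is a torsion group and for every prime $p$ the Sylow $p$-subgroup $S_p$ of $G$ is finite.
   Context: A ballean is a triple $(X,P,B)$ where $X,P$ are sets, $P\ne\emptyset$, and $B\colon X\times P\to\mathcal P(X)$ satisfies: $x\in B(x,\alpha)$; $x\in B(y,\alpha)$ iff $y\in B(x,\alpha)$; and for all $\alpha,\beta\in P$ there is $\gamma\in P$ such that $B(B(x,\alpha),\beta)\subseteq B(x,\gamma)$ for every $x\in X$, where $B(A,\delta)=\bigcup_{y\in A}B(y,\delta)$. An extended metric (a metric allowed to take the value $\infty$) $d$ on $X$ induces the metric ballean $(X,\mathbb R_{\ge0},B_d)$, with $B_d(x,R)$ the closed ball of centre $x$ and radius $R$. A ballean $(X,P,B)$ has asymptotic dimension at most $n\in\mathbb N$ if for every $\alpha\in P$ there is a cover $\mathcal U=\mathcal U_0\cup\dots\cup\mathcal U_n$ of $X$ which is uniformly bounded (there is $\gamma\in P$ with $U\subseteq B(x,\gamma)$ for all $U\in\mathcal U$, $x\in U$) and such that for each $i$ and all distinct $U,V\in\mathcal U_i$ one has $B(U,\alpha)\cap V=\emptyset$. $\operatorname{asdim}$ is the least such $n$, and $\infty$ if there is none. For a group $G$, let $L(G)$ be the set of all subgroups of $G$. The subgroup logarithmic hyperballean $\ell\text{-}\mathcal L(G)$ is the metric ballean on $L(G)$ induced by the extended metric $d(H,K)=\log\max\{|H:H\cap K|,|K:H\cap K|\}$ if both indices are finite, and $d(H,K)=\infty$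 otherwise (the base of the logarithm is any fixed real number $>1$). For an abelian group $G$ and a prime $p$, the Sylow $p$-subgroup $S_p$ is the maximal $p$-subgroup of $G$, i.e. the set of elements whose order is a power of $p$. *)

(* Defs.v *)
From HB Require Import structures.
From mathcomp Require Import all_boot all_order all_algebra finmap.
From mathcomp Require Import all_classical all_reals all_analysis.
Set Implicit Arguments.
Unset Strict Implicit.
Unset Printing Implicit Defensive.
Import Order.TTheory GRing.Theory Num.Theory.
Local Open Scope classical_set_scope.
Local Open Scope ring_scope.

(** * Balleans and asymptotic dimension *)

Record ballean := Ballean {
  bsupport : Type;
  bradius : Type;
  ball_of : bsupport -> bradius -> set bsupport;
  _ : inhabited bradius;
  _ : forall x a, ball_of x a x;
  _ : forall x y a, ball_of y a x <-> ball_of x a y;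
  _ : forall a b, exists g, forall x,
        \bigcup_(y in ball_of x a) ball_of y b `<=` ball_of x g
}.

Definition set_ball (X : ballean) (A : set (bsupport X)) (a : bradius X) :
  set (bsupport X) := \bigcup_(x in A) ball_of x a.

Definition asdim_le (X : ballean) (n : nat) : Prop :=
  forall a : bradius X, exists U : 'I_n.+1 -> set (set (bsupport X)),
    [/\ \bigcup_i \bigcup_(A in U i) A = setT,
        exists g : bradius X,
          forall i A x, U i A -> A x -> A `<=` ball_of x g
      & forall i A B, U i A -> U i B -> A <> B -> set_ball A a `&` B = set0].

Lemma exists_asbool (P : nat -> Prop) :
  (exists n, P n) -> exists n, (fun n => `[< P n >]) n.
Proof. by move=> [n Pn]; exists n; apply/asboolP. Qed.

Definition asdim (X : ballean) : \bar nat :=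
  if pselect (exists n, asdim_le X n) is left e
  then (ex_minn (exists_asbool e))%:E else +oo%E.

(** * Metric balleans *)

Record ext_metric (R : realType) (X : Type) := ExtMetric {
  edist :> X -> X -> \bar R;
  edist_ge0 : forall x y, (0 <= edist x y)%E;
  edist_eq0 : forall x y, edist x y = 0%E <-> x = y;
  edist_sym : forall x y, edist x y = edist y x;
  edist_triangle : forall x y z, (edist x z <= edist x y + edist y z)%E
}.

Definition metric_ball (R : realType) (X : Type) (d : ext_metric R X)
  (x : X) (r : {nonneg R}) : set X := [set y | (d x y <= r%:num%:E)%E].

Section MetricBallean.
Variables (R : realType) (X : Type) (d : ext_metric R X).

Lemma metric_ball_inhabited : inhabited {nonneg R}.
Proof. exact: (inhabits 0%:nng). Qed.

Lemma metric_ball_refl x r : metric_ball d x r x.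
Proof. by rewrite /metric_ball /= (edist_eq0 d x x).2. Qed.

Lemma metric_ball_sym x y r : metric_ball d y r x <-> metric_ball d x r y.
Proof. by rewrite /metric_ball /= edist_sym. Qed.

Lemma metric_ball_comp (r s : {nonneg R}) : exists t : {nonneg R}, forall x,
  \bigcup_(y in metric_ball d x r) metric_ball d y s `<=` metric_ball d x t.
Proof.
exists (r%:num + s%:num)%:nng => x z [y xy yz] /=.
rewrite /metric_ball /= EFinD.
exact: le_trans (edist_triangle d x y z) (leeD xy yz).
Qed.

Definition metric_ballean : ballean :=
  Ballean metric_ball_inhabited metric_ball_refl metric_ball_sym
          metric_ball_comp.

End MetricBallean.

(** * The subgroup logarithmic hyperballean of an abelian group *)

Definition subgroups (G : zmodType) : set (set G) :=
  [set H | zmod_closed (mem H)].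
Arguments subgroups G : clear implicits.

(* Written additively: the set of cosets [h + N] with [h] in [H]. *)
Definition cosets (G : zmodType) (H N : set G) : set (set G) :=
  [set [set h + n | n in N] | h in H].

Definition has_finite_index (G : zmodType) (H N : set G) : Prop :=
  finite_set (cosets H N).

(* Only meaningful when [has_finite_index H N] holds. *)
Definition subgroup_index (G : zmodType) (H N : set G) : nat :=
  #|` fset_set (cosets H N)|.

Definition log_dist (R : realType) (b : R) (G : zmodType)
    (H K : subgroups G) : \bar R :=
  let I := val H `&` val K in
  if `[< has_finite_index (val H) I /\ has_finite_index (val K) I >] then
    (ln (maxn (subgroup_index (val H) I) (subgroup_index (val K) I))%:R
      / ln b)%:E
  else +oo%E.

Section LogDist.
Variables (R : realType) (b : R) (b1 : 1 < b) (G : zmodType).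
Implicit Types H K L : subgroups G.

Lemma subgroups0 H : val H 0.
Proof. by have := valP H; rewrite inE => -[]; rewrite !inE. Qed.

Lemma subgroupsB H x y : val H x -> val H y -> val H (x - y).
Proof.
move=> Hx Hy; have := valP H; rewrite inE => -[_ /(_ x y)].
by rewrite !inE; apply.
Qed.

Lemma subgroupsD H x y : val H x -> val H y -> val H (x + y).
Proof.
move=> Hx Hy; rewrite -[y]opprK; apply: subgroupsB => //.
by rewrite -sub0r; apply: subgroupsB => //; exact: subgroups0.
Qed.

Lemma index_gt0 H N :
  has_finite_index (val H) N -> (0 < subgroup_index (val H) N)%N.
Proof.
move=> fN; rewrite cardfs_gt0; apply/fset0Pn.
exists [set 0 + n | n in N]; rewrite in_fset_set// inE.
by exists 0 => //; exact: subgroups0.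
Qed.

Lemma index_le1 H K : has_finite_index (val H) (val H `&` val K) ->
  (subgroup_index (val H) (val H `&` val K) <= 1)%N -> val H `<=` val K.
Proof.
move=> fN le1 x Hx.
have /cardfs1P[c cE] : subgroup_index (val H) (val H `&` val K) == 1%N.
  by rewrite eqn_leq le1 index_gt0.
have mem h : val H h ->
    [set h + n | n in val H `&` val K] \in
    fset_set (cosets (val H) (val H `&` val K)).
  by move=> Hh; rewrite in_fset_set// inE; exists h.
have := mem _ Hx; have := mem _ (subgroups0 H).
rewrite cE => /fset1P E0 /fset1P E.
have : [set x + n | n in val H `&` val K] x.
  by exists 0; [split; exact: subgroups0|rewrite addr0].
by rewrite E -E0 => -[n [_ Kn]]; rewrite add0r => <-.
Qed.

Lemma index_self H : has_finite_index (val H) (val H) /\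
  subgroup_index (val H) (val H) = 1%N.
Proof.
suff E : cosets (val H) (val H) = [set val H].
  by rewrite /has_finite_index /subgroup_index E fset_set1 cardfs1; split.
apply/seteqP; split=> [A [h Hh <-]|A ->] /=.
  apply/seteqP; split=> [_ [n Hn <-]|x Hx]; first exact: subgroupsD.
  by exists (x - h); [exact: subgroupsB|rewrite addrC subrK].
exists 0; first exact: subgroups0.
apply/seteqP; split=> [_ [n Hn <-]|x Hx]; first by rewrite add0r.
by exists x => //; rewrite add0r.
Qed.

Lemma index_trans H K L :
  let HK := val H `&` val K in let KL := val K `&` val L in
  let HL := val H `&` val L in
  has_finite_index (val H) HK -> has_finite_index (val K) KL ->
  has_finite_index (val H) HL /\
  (subgroup_index (val H) HL <=
     subgroup_index (val H) HK * subgroup_index (val K) KL)%N.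
Proof.
move=> HK KL HL f1 f2.
pose f (c : set G * set G) : set G :=
  [set xget 0 c.1 + xget 0 c.2 + l | l in val L] `&` val H.
have sub : cosets (val H) HL `<=`
    f @` (cosets (val H) HK `*` cosets (val K) KL).
  move=> _ [x Hx <-].
  pose c1 := [set x + n | n in HK].
  have c1x : c1 x.
    exists 0; last by rewrite addr0.
    by split; exact: subgroups0.
  have [n1 [Hn1 Kn1] e1] := xgetI 0 c1x.
  pose y := - n1.
  have Ky : val K y.
    by rewrite /y -sub0r; apply: subgroupsB => //; exact: subgroups0.
  pose c2 := [set y + n | n in KL].
  have c2y : c2 y.
    exists 0; last by rewrite addr0.
    by split; exact: subgroups0.
  have [n2 [Kn2 Ln2] e2] := xgetI 0 c2y.
  exists (c1, c2); first by split => /=; [exists x|exists y].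
  have e : xget 0 c1 + xget 0 c2 = x + n2.
    by rewrite -e1 -e2 /y addrA addrK.
  rewrite /f /= e; apply/seteqP; split=> [z [[l Ll <-] Hz]|_ [n [Hn Ln] <-]].
    exists (n2 + l); last by rewrite addrA.
    split; last exact: subgroupsD.
    have -> : n2 + l = x + n2 + l - x by rewrite [RHS]addrC -(addrA x) addKr.
    exact: subgroupsB.
  split; last exact: subgroupsD.
  exists (n - n2); first exact: subgroupsB.
  by rewrite -addrA [n2 + _]addrC subrK.
have fX : finite_set (cosets (val H) HK `*` cosets (val K) KL).
  exact: finite_setX.
have fI := finite_image f fX.
have fL : has_finite_index (val H) HL := sub_finite_set sub fI.
split => //; rewrite /subgroup_index.
rewrite -(size_allpairs (fun c1 c2 => f (c1, c2))).
apply: uniq_leq_size => // c; rewrite in_fset_set// inE => /sub.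
move=> [[c1 c2] [/= C1 C2] <-]; apply/allpairsP; exists (c1, c2).
by split => //=; rewrite in_fset_set// inE.
Qed.

Lemma log_dist_ge0 H K : (0 <= log_dist b H K)%E.
Proof.
rewrite /log_dist; case: asboolP => // -[fH fK].
rewrite lee_fin divr_ge0 ?ln_ge0 ?(ltW b1)//.
by rewrite ler1n leq_max index_gt0.
Qed.

Lemma log_dist_eq0 H K : log_dist b H K = 0%E <-> H = K.
Proof.
have lnb := ln_gt0 b1.
rewrite /log_dist; split=> [|<-]; last first.
  rewrite setIid; have [f ->] := index_self H.
  by rewrite asboolT// maxnn ln1 mul0r.
case: asboolP => // -[fH fK] [] /eqP.
have m0 : (0 < maxn (subgroup_index (val H) (val H `&` val K))
                    (subgroup_index (val K) (val H `&` val K)))%N.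
  by rewrite leq_max index_gt0.
rewrite mulf_eq0 invr_eq0 (gt_eqF lnb) orbF ln_eq0 ?ltr0n//.
rewrite pnatr_eq1 => /eqP m1.
apply: val_inj; apply/seteqP; split; apply: index_le1 => //.
- by rewrite -m1 leq_maxl.
- by rewrite setIC.
- by rewrite [val K `&` _]setIC -m1 leq_maxr.
Qed.

Lemma log_dist_sym H K : log_dist b H K = log_dist b K H.
Proof.
rewrite /log_dist [val K `&` _]setIC maxnC.
by congr (if _ then _ else _); apply: asbool_equiv_eq; split=> -[].
Qed.

Lemma log_dist_triangle H K L :
  (log_dist b H L <= log_dist b H K + log_dist b K L)%E.
Proof.
rewrite {2}/log_dist; case: asboolP => [[f1 f2]|_]; last first.
  by rewrite addye ?leey// -ltNye; exact: lt_le_trans (log_dist_ge0 _ _).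
rewrite {2}/log_dist; case: asboolP => [[f3 f4]|_]; last first.
  by rewrite addey ?leey.
have [f5 le5] := index_trans f1 f3.
have [f6 le6] : has_finite_index (val L) (val H `&` val L) /\
    (subgroup_index (val L) (val H `&` val L) <=
       subgroup_index (val L) (val K `&` val L) *
       subgroup_index (val K) (val H `&` val K))%N.
  rewrite (setIC (val H) (val L)) (setIC (val K) (val L)).
  rewrite (setIC (val H) (val K)).
  by apply: index_trans; [rewrite setIC|rewrite setIC].
rewrite /log_dist asboolT// -EFinD lee_fin -mulrDl.
rewrite ler_pM2r ?invr_gt0 ?ln_gt0//.
have p1 := index_gt0 f1; have p3 := index_gt0 f3; have p5 := index_gt0 f5.
rewrite -lnM ?posrE ?ltr0n ?leq_max ?p1 ?p3// -natrM.
rewrite ler_ln ?posrE ?ltr0n ?muln_gt0 ?leq_max ?p1 ?p3 ?p5//.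
rewrite ler_nat geq_max; apply/andP; split.
  by apply: leq_trans le5 _; apply: leq_mul; exact: leq_maxl.
by apply: leq_trans le6 _; rewrite mulnC; apply: leq_mul; exact: leq_maxr.
Qed.

Definition log_metric : ext_metric R (subgroups G) :=
  ExtMetric log_dist_ge0 log_dist_eq0 log_dist_sym log_dist_triangle.

Definition log_hyperballean : ballean := metric_ballean log_metric.

End LogDist.

(** * Torsion and Sylow subgroups *)

Definition has_order (G : zmodType) (x : G) (n : nat) : Prop :=
  [/\ (0 < n)%N, x *+ n = 0
    & forall m, (0 < m)%N -> x *+ m = 0 -> (n <= m)%N].

Definition torsion_group (G : zmodType) : Prop :=
  forall x : G, exists n, has_order x n.

Definition Sylow_subgroup (G : zmodType) (p : nat) : set G :=
  [set x | exists k, has_order x (p ^ k)].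
Arguments Sylow_subgroup G p : clear implicits.

(* Main.v *)
Require Import Defs.
From mathcomp Require Import all_boot all_order all_algebra.
From mathcomp Require Import all_classical all_reals all_analysis.
From mathcomp Require Import zify.
Set Implicit Arguments.
Unset Strict Implicit.
Unset Printing Implicit Defensive.
Import Order.TTheory GRing.Theory Num.Theory.
Local Open Scope classical_set_scope.
Local Open Scope ring_scope.

(** Asymptotic dimension zero means that, for each scale, chains with steps of
    that scale stay at a bounded distance from their origin ([asdim0_chain]). In
    the hyperballean the scale amounts to a bound [m] on the two indices of
    [H `&` K] in [H] and in [K] ([ball_close], [close_ball]).

    An ascending chain of subgroups with [n] strict steps of index at most [m]
    has a last term in which the first has index at least [n], so in dimension
    zero the lengths of such chains are bounded for each [m] ([chain_bound]).
    An element of infinite order gives arbitrarily long chains of cyclic groups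
    with steps of index [2] ([asdim0_torsion]), and an infinite Sylow
    [p]-subgroup contains arbitrarily long chains of finite groups with steps of
    index [p] ([asdim0_Sylow_finite]).

    Conversely, a torsion group is the direct sum of its part [F] at the primes
    up to [m] and of its part at the larger primes. Passing to a subgroup of
    index at most [m] does not change the second part of a subgroup
    ([close_core]), so this part is constant on every chain at scale [m]. When
    the Sylow subgroups are finite so is [F] ([finite_killed]), and two subgroups
    with the same second part have an intersection of index at most [#|F|] in
    each ([core_close]). The fibres of [core m] are therefore the required
    cover. *)

(** * Balleans of asymptotic dimension zero *)

Lemma asdim_eq0 (X : ballean) : asdim X = 0%N%:E <-> asdim_le X 0.
Proof.
rewrite /asdim; case: pselect => [e|ne]; last first.
  by split=> // X0; case: ne; exists 0%N.
case: ex_minnP => m /asboolP Xm mmin; split=> [[m0]|X0].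
  by rewrite -m0.
have /mmin : `[< asdim_le X 0 >] by exact/asboolP.
by rewrite leqn0 => /eqP ->.
Qed.

(** A cell of the cover at scale [a] that contains [x] contains every [y] in
    the ball of radius [a] around [x], since distinct cells are [a]-disjoint.
    Hence a chain with steps of size [a] never leaves its first cell, whatever
    its length. *)
Lemma asdim0_chain (X : ballean) : asdim_le X 0 ->
  forall a : bradius X, exists g : bradius X, forall n (c : nat -> bsupport X),
    (forall i, (i < n)%N -> ball_of (c i) a (c i.+1)) -> ball_of (c 0%N) g (c n).
Proof.
move=> X0 a; have [U [cov [g bnd] sep]] := X0 a; exists g => n c step.
have ex x : exists2 A, U ord0 A & A x.
  have : [set: bsupport X] x by [].
  by rewrite -cov => -[i _ [A UA Ax]]; exists A => //; rewrite (ord1 i) in UA.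
have [A UA A0] := ex (c 0%N).
suff Ai i : (i <= n)%N -> A (c i) by apply: (bnd ord0 A) => //; exact: Ai.
elim: i => // i IH lein; have [B UB Bi] := ex (c i.+1).
suff -> : A = B by [].
apply: contrapT => AB; have : set0 (c i.+1); last by [].
rewrite -(sep _ _ _ UA UB AB); split=> //.
by exists (c i); [exact/IH/ltnW|exact: step].
Qed.

(** * Balls of the logarithmic metric in terms of indices *)

Definition index_le (G : zmodType) (n : nat) (H N : set G) : Prop :=
  has_finite_index H N /\ (subgroup_index H N <= n)%N.

(** The coarse structure of the logarithmic metric, freed from the base and from
    the real numbers: [ball_close] and [close_ball] compare the two. *)
Definition close (G : zmodType) (n : nat) (H K : subgroups G) : Prop :=
  index_le n (val H) (val H `&` val K) /\ index_le n (val K) (val H `&` val K).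

Lemma close_sym (G : zmodType) n (H K : subgroups G) : close n H K -> close n K H.
Proof. by case=> HI KI; rewrite /close setIC. Qed.

Section Balls.
Variables (R : realType) (b : R) (b1 : 1 < b) (G : zmodType).

Lemma ball_close (r : R) : exists n : nat, forall H K : subgroups G,
  (log_dist b H K <= r%:E)%E -> close n H K.
Proof.
have lnb := ln_gt0 b1.
exists (Num.bound (expR (r * ln b))) => H K; rewrite /log_dist.
case: asboolP => [[fH fK]|_]; last by rewrite leye_eq.
rewrite lee_fin ler_pdivrMr// => le.
have : (maxn (subgroup_index (val H) (val H `&` val K))
             (subgroup_index (val K) (val H `&` val K))
       <= Num.bound (expR (r * ln b)))%N.
  rewrite -(ler_nat R); apply: le_trans (ltW (archi_boundP (expR_ge0 _))).
  by rewrite -ler_expR lnK ?posrE ?ltr0n ?leq_max ?index_gt0 in le.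
by rewrite geq_max => /andP[].
Qed.

Lemma close_ball (n : nat) : exists r : {nonneg R}, forall H K : subgroups G,
  close n H K -> (log_dist b H K <= r%:num%:E)%E.
Proof.
have lnb := ln_gt0 b1.
have r0 : 0 <= ln n.+1%:R / ln b.
  by rewrite divr_ge0 ?(ltW lnb)// ln_ge0// ler1n.
exists (NngNum r0) => H K [[fH leH] [fK leK]].
rewrite /log_dist asboolT//= lee_fin ler_pM2r ?invr_gt0//.
rewrite ler_ln ?posrE ?ltr0n ?leq_max ?index_gt0//.
by rewrite ler_nat leqW// geq_max leH.
Qed.

End Balls.

(** * Indices and ascending chains of subgroups *)

Section Subgroups.
Context {G : zmodType}.
Implicit Types (H K : subgroups G) (x y : G).

Lemma subgroupsN H x : val H x -> val H (- x).
Proof. by move=> Hx; rewrite -sub0r; apply: subgroupsB => //; exact: subgroups0. Qed.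

Lemma subgroupsMn H x n : val H x -> val H (x *+ n).
Proof.
move=> Hx; elim: n => [|n IH]; first by rewrite mulr0n; exact: subgroups0.
by rewrite mulrS; exact: subgroupsD.
Qed.

Lemma subgroupsMz H x z : val H x -> val H (x *~ z).
Proof.
by move=> Hx; case: z => n; [|apply: subgroupsN]; exact: subgroupsMn.
Qed.

Lemma subgroup_of (A : set G) : A 0 -> (forall x y, A x -> A y -> A (x - y)) ->
  exists H, val H = A.
Proof.
move=> A0 AB; have SA : A \in subgroups G.
  rewrite inE; split; rewrite ?inE// => x y; rewrite !inE; exact: AB.
by exists (SigSub SA).
Qed.

(** The coset of [x] is the coset of [f], so there are at most as many cosets as
    entries in [s]. *)
Lemma index_le_cover H K (s : seq G) :
  (forall x, val H x -> exists2 f, f \in s & (val H `&` val K) (x - f)) ->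
  index_le (size s) (val H) (val H `&` val K).
Proof.
move=> cov; pose coset f := [set f + n | n in val H `&` val K].
have sub : cosets (val H) (val H `&` val K) `<=` [set` map coset s].
  move=> _ [x Hx <-] /=; have [f fs [Hxf Kxf]] := cov x Hx.
  apply/mapP; exists f => //.
  apply/seteqP; split=> _ [n [Hn Kn] <-].
    exists (x - f + n); last by rewrite addrA [f + _]addrC subrK.
    by split; exact: subgroupsD.
  exists (n - (x - f)); last by rewrite opprB addrCA [x + _]addrC subrK addrC.
  by split; exact: subgroupsB.
have fin : has_finite_index (val H) (val H `&` val K).
  exact: sub_finite_set sub (finite_seq _).
split=> //; rewrite /subgroup_index -(size_map coset s).
apply: uniq_leq_size => // c; rewrite in_fset_set// inE; exact: sub.
Qed.

Lemma index_le_pigeonhole H K n (x : nat -> G) :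
  index_le n (val H) (val H `&` val K) ->
  (forall i, (i <= n)%N -> val H (x i)) ->
  exists i j, [/\ (i < j)%N, (j <= n)%N & val K (x j - x i)].
Proof.
move=> [fin le] Hx; apply: contrapT => no.
pose coset f := [set f + n | n in val H `&` val K].
have inj i j : (i < j)%N -> (j <= n)%N -> coset (x i) <> coset (x j).
  move=> ij jn E; apply: no; exists i, j; split=> //.
  have : coset (x j) (x j).
    by exists 0; [split; exact: subgroups0|rewrite addr0].
  by rewrite -E => -[k [_ Kk] <-]; rewrite addrC addKr.
have : (n.+1 <= subgroup_index (val H) (val H `&` val K))%N.
  rewrite -[X in (X <= _)%N](size_iota 0) -(size_map (coset \o x)).
  apply: uniq_leq_size => [|c /mapP[i]].
    rewrite map_inj_in_uniq ?iota_uniq// => i j.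
    rewrite !mem_iota !add0n /= !ltnS => lei lej E.
    by case: (ltngtP i j) => // ij; [case: (inj _ _ ij lej)|case: (inj _ _ ij lei)].
  rewrite mem_iota /= add0n ltnS => lei ->; rewrite in_fset_set// inE.
  by exists (x i) => //; exact: Hx.
by rewrite leqNgt ltnS le.
Qed.

(** [K] is the subgroup generated by [H] and [x]. A relation rather than a
    function, because in the cyclic chains of [asdim0_torsion] the larger group
    is given beforehand. *)
Definition adjoins H K x := forall y, val K y <-> exists z : int, val H (y - x *~ z).

Lemma adjoin_ex H x : exists K, adjoins H K x.
Proof.
have [||K KE] := @subgroup_of [set y | exists z : int, val H (y - x *~ z)].
- by exists 0; rewrite mulr0z subr0; exact: subgroups0.
- move=> y1 y2 [z1 H1] [z2 H2]; exists (z1 - z2).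
  rewrite mulrzBr opprB addrACA [- y2 - _]addrC -addrACA -[_ - y2]opprB.
  exact: subgroupsB.
by exists K => y; rewrite KE.
Qed.

Lemma adjoins_mem H K x : adjoins H K x -> val K x.
Proof. by move=> /(_ x) ->; exists 1; rewrite mulr1z subrr; exact: subgroups0. Qed.

Lemma adjoins_sub H K x : adjoins H K x -> val H `<=` val K.
Proof. by move=> HK y Hy; apply/HK; exists 0; rewrite mulr0z subr0. Qed.

Lemma adjoins_multiple H K x m y : (0 < m)%N -> adjoins H K x ->
  val H (x *+ m) -> val K y -> exists2 k, (k < m)%N & val H (y - x *+ k).
Proof.
move=> m0 HK Hm /HK[z Hz].
have m0' : (m : int) != 0 by rewrite eqz_nat -lt0n.
have [k kE] : exists k : nat, (z %% m)%Z = k.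
  by exists `|(z %% m)%Z|%N; rewrite gez0_abs// modz_ge0.
exists k; first by rewrite -ltz_nat -kE ltz_pmod.
have -> : y - x *+ k = y - x *~ z + x *+ m *~ (z %/ m)%Z.
  rewrite {1}(divz_eq z m) kE mulrzDr opprD !pmulrn -mulrzA.
  by rewrite [(z %/ m)%Z * _]mulrC [- _ - _]addrC addrA subrK.
by apply: subgroupsD => //; exact: subgroupsMz.
Qed.

Lemma adjoins_close H K x m : (0 < m)%N -> adjoins H K x -> val H (x *+ m) ->
  close m H K.
Proof.
move=> m0 HK Hm; split.
  have /(_ _)[|fin le] := @index_le_cover H K [:: 0].
    by move=> y Hy; exists 0; rewrite ?inE// subr0; split=> //; apply: adjoins_sub Hy.
  by split=> //; exact: leq_trans m0.
rewrite setIC -[m](size_iota 0) -(size_map (fun k => x *+ k)).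
apply: index_le_cover => y Ky.
have [k km Hk] := adjoins_multiple m0 HK Hm Ky; exists (x *+ k).
  by apply: map_f; rewrite mem_iota.
by split=> //; exact: adjoins_sub Hk.
Qed.

(** An ascending chain of [n] strict steps, each of index at most [m]. *)
Definition chain m n (H : nat -> subgroups G) (x : nat -> G) := forall i, (i < n)%N ->
  [/\ adjoins (H i) (H i.+1) (x i), val (H i) (x i *+ m) & ~ val (H i) (x i)].

End Subgroups.

(** * Dimension zero forces torsion and finite Sylow subgroups *)

Section Necessity.
Variables (R : realType) (b : R) (b1 : 1 < b) (G : zmodType).

(** Consecutive terms are [m]-close, so by [asdim0_chain] the end [H n] is at a
    bounded distance from [H 0]; but [x 0], ..., [x n.-1] lie in distinct
    cosets of [H 0], since [x j] is not in [H j] while [H j] contains [H 0] and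
    [x i] for [i < j]. *)
Lemma chain_bound m : asdim_le (log_hyperballean b1 G) 0 -> (0 < m)%N ->
  exists N, forall n (H : nat -> subgroups G) x, chain m n H x -> (n <= N)%N.
Proof.
move=> X0 m0; have [r mr] := close_ball b1 G m.
have [g gP] := asdim0_chain X0 r.
have [N NP] := ball_close b1 G g%:num.
exists N => n H x ch; rewrite leqNgt; apply/negP => Nn.
have step i : (i < n)%N -> (log_dist b (H i) (H i.+1) <= r%:num%:E)%E.
  by move=> /ch[HK Hm _]; apply: mr; exact: adjoins_close HK Hm.
have /NP[_ ind] := gP n H step.
have mono i j : (i <= j)%N -> (j <= n)%N -> val (H i) `<=` val (H j).
  elim: j => [|j IH]; first by rewrite leqn0 => /eqP -> _ y.
  rewrite leq_eqVlt => /predU1P[-> _ y//|]; rewrite ltnS => ij jn.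
  have [/adjoins_sub Hj _ _] := ch j jn.
  exact: subset_trans (IH ij (ltnW jn)) Hj.
rewrite setIC in ind.
have [i iN|i [j [ij jN]]] := index_le_pigeonhole ind (x := x).
  have iltn : (i < n)%N by lia.
  by have [/adjoins_mem xi _ _] := ch i iltn; exact: mono xi.
have jn : (j < n)%N by lia.
have iltn : (i < n)%N by lia.
have [_ _ nj] := ch j jn; have [/adjoins_mem xi _ _] := ch i iltn.
move=> H0; apply: nj; rewrite -[x j](subrK (x i)); apply: subgroupsD.
  by apply: mono H0 => //; exact: ltnW.
by apply: mono xi => //; exact: ltnW.
Qed.

(** An element [x] of infinite order gives the chain of the cyclic groups
    generated by [2 ^ N x], ..., [2 x], [x], whose length is arbitrary. *)
Lemma asdim0_torsion : asdim_le (log_hyperballean b1 G) 0 -> torsion_group G.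
Proof.
move=> X0 x; apply: contrapT => noord.
have xn0 n : (0 < n)%N -> x *+ n <> 0.
  move=> n0 xn; apply: noord.
  have ex : exists n, (0 < n)%N && (x *+ n == 0) by exists n; rewrite n0 xn eqxx.
  case: (ex_minnP ex) => k /andP[k0 /eqP xk] kmin; exists k; split=> // m m0 xm.
  by apply: kmin; rewrite m0 xm eqxx.
have xz0 (z : int) : z != 0 -> x *~ z <> 0.
  case: z => n; first by rewrite eqz_nat -lt0n; exact: xn0.
  by move=> _ /eqP; rewrite NegzE mulrNz oppr_eq0 => /eqP; exact: xn0.
have [N NP] := chain_bound X0 (ltn0Sn 1).
have cyc k : exists H : subgroups G,
    val H = [set y | exists z : int, y = x *~ (z * k)].
  apply: subgroup_of; first by exists 0; rewrite mul0r mulr0z.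
  by move=> _ _ [z1 ->] [z2 ->]; exists (z1 - z2); rewrite mulrBl mulrzBr.
have [C CE] := choice cyc.
suff /NP : chain 2 N.+1 (fun i => C ((2 ^ (N.+1 - i))%N : int))
    (fun i => x *+ 2 ^ (N - i)).
  by rewrite ltnn.
move=> i iN; have E : (2 ^ (N.+1 - i))%N%:Z = 2 * (2 ^ (N - i))%N%:Z.
  by rewrite subSn// expnS PoszM.
have p0 : (2 ^ (N - i))%N%:Z != 0 by rewrite eqz_nat expn_eq0.
rewrite subSS; split.
- move=> y; rewrite !CE E /=; split=> [[z ->]|[z [w /eqP]]].
    by exists z; exists 0; rewrite mul0r mulr0z pmulrn -mulrzA mulrC subrr.
  rewrite subr_eq pmulrn -mulrzA -mulrzDr => /eqP ->; exists (w * 2 + z).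
  by rewrite [(_ + z) * _]mulrDl -mulrA [_ * z]mulrC.
- by rewrite CE E; exists 1; rewrite mul1r mulrC mulrzA -pmulrn.
rewrite CE E /= => -[z] /eqP; rewrite -subr_eq0 pmulrn -mulrzBr => /eqP.
apply: xz0; rewrite mulrA -{1}[(2 ^ _)%N%:Z]mul1r -mulrBl mulf_neq0//.
lia.
Qed.

(** When the Sylow subgroup is infinite, no finite subgroup [H] contains it: for
    [x] outside [H] of order a power of [p], the last of the [x *+ p ^ k] outside
    [H] can be adjoined to [H] as the next step of a chain of finite
    subgroups. *)
Lemma asdim0_Sylow_finite p : asdim_le (log_hyperballean b1 G) 0 ->
  prime p -> finite_set (Sylow_subgroup G p).
Proof.
move=> X0 pp; apply: contrapT => infS; have p0 := prime_gt0 pp.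
have [N NP] := chain_bound X0 p0.
pose good H (xK : G * subgroups G) := [/\ adjoins H xK.2 xK.1,
  val H (xK.1 *+ p), ~ val H xK.1 & finite_set (val xK.2)].
have ext H : finite_set (val H) -> exists xK, good H xK.
  move=> finH.
  have [x [k [_ xk _]] nHx] : exists2 x, Sylow_subgroup G p x & ~ val H x.
    apply: contrapT => no; apply: infS; apply: sub_finite_set finH => x Sx.
    by apply: contrapT => nHx; apply: no; exists x.
  have [y nHy Hpy] : exists2 y, ~ val H y & val H (y *+ p).
    have Hxk : val H (x *+ p ^ k) by rewrite xk; exact: subgroups0.
    elim: k {xk} Hxk => [|k IH] Hxk; first by rewrite expn0 mulr1n in Hxk.
    have [/IH//|nHxk] := pselect (val H (x *+ p ^ k)).
    by exists (x *+ p ^ k) => //; rewrite -mulrnA -expnSr.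
  have [K HK] := adjoin_ex H y; exists (y, K); split=> //=.
  apply: (@sub_finite_set _ _
    ((fun hk => hk.1 + y *+ hk.2) @` (val H `*` `I_p))).
    move=> z /(adjoins_multiple p0 HK Hpy)[l lp Hl].
    by exists (z - y *+ l, l) => //=; rewrite subrK.
  by apply: finite_image; apply: finite_setX => //; exact: finite_II.
(* The default [(0, H)] makes the extension a total function, to be iterated. *)
have ext' H : exists xK, finite_set (val H) -> good H xK.
  have [/ext[xK]|nfinH] := pselect (finite_set (val H)); first by exists xK.
  by exists (0, H).
have [f fP] := choice ext'.
have [H0 H0E] : exists H : subgroups G, val H = [set 0].
  by apply: subgroup_of => // x y -> ->; rewrite subrr.
pose H i := iter i (fun H => (f H).2) H0.
have finH i : finite_set (val (H i)).
  elim: i => [|i /fP[]//]; rewrite /= H0E; exact: finite_set1.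
suff /NP : chain p N.+1 H (fun i => (f (H i)).1) by rewrite ltnn.
by move=> i _; have [] := fP _ (finH i).
Qed.

End Necessity.

(** * Finite Sylow subgroups give dimension zero *)

Section Sufficiency.
Context {G : zmodType}.
Implicit Types (H K : subgroups G) (x : G).

Definition killed (pi : nat_pred) x := exists2 k, pi.-nat k & x *+ k = 0.

(** Bezout for the coprime factors [n`_pi] and [n`_pi^'] of [n]. Both parts are
    multiples of [x], so they stay in every subgroup that contains [x]. *)
Lemma primary_split (pi : nat_pred) x n : (0 < n)%N -> x *+ n = 0 ->
  exists u v, [/\ x = x *+ u - x *+ v,
    x *+ u *+ (n`_pi^')%N = 0 & x *+ v *+ (n`_pi)%N = 0].
Proof.
move=> n0 xn; have nE := partnC pi n0.
have /coprimeP : coprime (n`_pi)%N (n`_pi^')%N by exact: coprime_partC.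
case=> [|[u v] /= uv]; first exact: part_gt0.
exists (u * n`_pi)%N, (v * n`_pi^')%N; split.
- by rewrite -mulrnBr ?uv//; lia.
- by rewrite -mulrnA -mulnA nE mulnC mulrnA xn mul0rn.
- by rewrite -mulrnA -mulnA [(n`_pi^' * _)%N]mulnC nE mulnC mulrnA xn mul0rn.
Qed.

(** As [d] is invertible modulo [k], [x] is a multiple of [x *+ d]. *)
Lemma mem_coprime_multiple H x d k : (0 < d)%N -> coprime d k ->
  x *+ k = 0 -> val H (x *+ d) -> val H x.
Proof.
move=> d0 /(coprimeP _ d0)[[u v] /= uv] xk Hxd.
have -> : x = x *+ d *+ u - x *+ k *+ v.
  rewrite -!mulrnA -mulrnBr; last by lia.
  by rewrite ![(_ * u)%N]mulnC [(_ * v)%N]mulnC uv.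
by rewrite xk mul0rn subr0; exact: subgroupsMn.
Qed.

Lemma killed_prime_Sylow p x : prime p -> killed p x -> Sylow_subgroup G p x.
Proof.
move=> pp [k pk xk]; have /andP[pk_gt0 _] := pk.
have ex : exists n, (0 < n)%N && (x *+ n == 0).
  by exists k; rewrite pk_gt0 xk eqxx.
case: (ex_minnP ex) => n /andP[n0 /eqP xn] nmin.
have ndvd : (n %| k)%N.
  rewrite /dvdn; apply: contraT => r0.
  suff : (n <= k %% n)%N by rewrite leqNgt ltn_mod n0.
  rewrite nmin// lt0n r0/=; apply/eqP.
  by move: xk; rewrite {1}(divn_eq k n) mulrnDr mulnC mulrnA xn mul0rn add0r.
have /p_natP[j nE] := pnat_dvd ndvd pk.
exists j; rewrite -nE; split=> // m m0 xm.
by apply: nmin; rewrite m0 xm eqxx.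
Qed.

(** Induction on [s]: the group for [p :: s] is the sum of the group for [s] and,
    when [p] is prime, the Sylow [p]-subgroup. *)
Lemma finite_killed (s : seq nat) :
  (forall p, prime p -> finite_set (Sylow_subgroup G p)) ->
  finite_set [set x | killed [pred p in s] x].
Proof.
move=> fS; elim: s => [|p s IH].
  apply: sub_finite_set (finite_set1 0) => x [k sk].
  by rewrite (@pnat_1 [pred p in [::]] k sk)//; apply: sub_in_pnat sk.
have [pp|np] := boolP (prime p); last first.
  apply: sub_finite_set IH => x [k sk xk]; exists k => //.
  have /andP[k0 _] := sk; apply/pnatP => // q qp qk.
  have := (pnatP _ k0 sk) q qp qk; rewrite !inE => /predU1P[qE|//].
  by rewrite qE (negPf np) in qp.
apply: (@sub_finite_set _ _
  ((fun yz => yz.1 - yz.2) @` ([set x | killed [pred p in s] x] `*` Sylow_subgroup G p))).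
  move=> x [k sk xk]; have /andP[k0 _] := sk.
  have [u [v [xE xu xv]]] := primary_split p k0 xk.
  exists (x *+ u, x *+ v); last by rewrite /= -xE.
  split=> /=; last first.
    by apply: killed_prime_Sylow => //; exists (k`_p)%N => //; exact: part_pnat.
  exists (k`_p^')%N => //; have := pnat_dvd (dvdn_part p^'%N k) sk.
  have := part_pnat (p^')%N k; rewrite /pnat part_gt0 /= => /allP np /allP sp.
  apply/allP => q qk; have := sp q qk; rewrite !inE => /predU1P[qp|//].
  by have := np q qk; rewrite !inE qp eqxx.
by apply: finite_image; apply: finite_setX => //; exact: fS.
Qed.

(** Stands for the primes at most [m], as membership in a list for the sake of
    the induction in [finite_killed]. *)
Definition small m : nat_pred := [pred p in iota 0 m.+1].

Lemma small_pnat m d : (0 < d <= m)%N -> (small m).-nat d.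
Proof.
move=> /andP[d0 dm]; apply/pnatP => // p _ /dvdn_leq pd.
by have : p \in iota 0 m.+1 by rewrite mem_iota ltnS (leq_trans (pd d0) dm).
Qed.

(** The part of [H] without torsion at the primes up to [m]: the invariant whose
    fibres are the cells of the cover in [asdim_le0_of_finite_Sylow]. *)
Definition core m H := [set x | val H x /\ killed (small m)^'%N x].

(** Among [0], [x], ..., [x *+ m] two agree modulo [K], so [x *+ d] is in [K]
    for some [0 < d <= m]; the prime factors of [d] are at most [m], so [d] is
    coprime to the order of an [x] in the core. *)
Lemma close_core_sub m H K : close m H K -> core m H `<=` core m K.
Proof.
move=> [ind _] x [Hx [k sk xk]]; split; last by exists k.
have [i im|i [j [ij jm Kx]]] := index_le_pigeonhole ind (x := fun i => x *+ i).
  exact: subgroupsMn.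
rewrite -mulrnBr ?(ltnW ij)// in Kx.
apply: mem_coprime_multiple xk Kx; first by rewrite subn_gt0.
by apply: pnat_coprime sk; apply: small_pnat; lia.
Qed.

Lemma close_core m H K : close m H K -> core m H = core m K.
Proof.
by move=> HK; apply/seteqP; split; apply: close_core_sub => //; exact: close_sym.
Qed.

(** Each [x] in [H] is the sum of an element of the core, which lies in [K], and
    of an element killed by small primes only: the latter represent all the
    cosets. *)
Lemma core_index_le m H K (s : seq G) : torsion_group G ->
  [set x | killed (small m) x] `<=` [set` s] -> core m H `<=` core m K ->
  index_le (size s) (val H) (val H `&` val K).
Proof.
move=> tG sub cHK; rewrite -(size_map -%R); apply: index_le_cover => x Hx.
have [n [n0 xn _]] := tG x.
have [u [v [xE xu xv]]] := primary_split (small m) n0 xn.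
have ku : killed (small m)^'%N (x *+ u).
  by exists (n`_(small m)^')%N => //; exact: part_pnat.
have kv : killed (small m) (x *+ v) by exists (n`_(small m))%N => //; exact: part_pnat.
exists (- (x *+ v)); first by apply: map_f; exact: sub.
rewrite opprK {1}xE subrK; split; first exact: subgroupsMn.
by have [] := cHK (x *+ u) (conj (subgroupsMn u Hx) ku).
Qed.

Lemma core_close m : torsion_group G ->
  (forall p, prime p -> finite_set (Sylow_subgroup G p)) ->
  exists N, forall H K, core m H = core m K -> close N H K.
Proof.
move=> tG fS; have /finite_seqP[s sE] := finite_killed (iota 0 m.+1) fS.
exists (size s) => H K E; have sub : [set x | killed (small m) x] `<=` [set` s].
  by rewrite -sE.
by split; [|rewrite setIC]; apply: core_index_le tG sub _; rewrite E.
Qed.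

End Sufficiency.

(** Subgroups in different fibres of [core m] are not [m]-close, which separates
    the cells, and those in a single fibre are uniformly close by
    [core_close]. *)
Lemma asdim_le0_of_finite_Sylow (R : realType) (b : R) (b1 : 1 < b) (G : zmodType) :
  torsion_group G -> (forall p, prime p -> finite_set (Sylow_subgroup G p)) ->
  asdim_le (log_hyperballean b1 G) 0.
Proof.
move=> tG fS r; have [m mP] := ball_close b1 G r%:num.
have [N NP] := core_close m tG fS; have [g gP] := close_ball b1 G N.
exists (fun _ => [set A | exists c, A = [set H | core m H = c]]); split.
- apply/seteqP; split=> // H _; exists ord0 => //.
  by exists [set K | core m K = core m H] => //; exists (core m H).
- by exists g => _ _ H [c ->] /= Hc K /= Kc; apply/gP/NP; rewrite Hc Kc.
move=> _ _ _ [c1 ->] [c2 ->] ne; apply/seteqP; split=> // K [[H /= Hc1 HK] Kc2].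
by apply: ne; rewrite -Hc1 -Kc2 (close_core (mP _ _ HK)).
Qed.

Theorem theorem3p24 (R : realType) (b : R) (b1 : 1 < b) (G : zmodType) :
  asdim (log_hyperballean b1 G) = 0%N%:E <->
  torsion_group G /\
  forall p : nat, prime p -> finite_set (Sylow_subgroup G p).
Proof.
rewrite asdim_eq0; split=> [X0|[tG fS]]; last exact: asdim_le0_of_finite_Sylow.
by split=> [|p]; [exact: asdim0_torsion X0|exact: asdim0_Sylow_finite X0].
Qed.
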